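(* Let $\overline{M}=I\times F$ be a Lorentzian product of dimension $n+1>2$ whose fiber $F$ has non-negative Ricci curvature. Then there is no complete parabolic spacelike hypersurface in $\overline{M}$ with bounded hyperbolic angle and constant mean curvature $H\neq 0$.
   Context: Let $n\ge 2$, let $(F,g_F)$ be a connected $n$-dimensional Riemannian manifold and $I\subset\mathbb{R}$ an open interval. The Lorentzian product $\overline{M}=I\times F$ carries the Lorentzian metric $\bar g=-\pi_I^*(dt^2)+\pi_F^*(g_F)$, where $\pi_I,\pi_F$ are the projections; $\partial_t=\partial/\partial t$ is the unit timelike coordinate vector field. A spacelike hypersurface is an immersion $\psi:M\to\overline{M}$ of an $n$-dimensional manifold $M$ whose induced metric $g_M$ is Riemannian; complete and parabolic refer to $(M,g_M)$. Let $N$ be the unique unit timelike normal vector field along $\psi$ with the same time-orientation as $-\partial_t$, i.e. $\bar g(N,\partial_t)>0$. The shape operator is $AX=-\overline{\nabla}_XN$ and the mean curvature is $H=-\frac1n\mathrm{trace}(A)$. The hyperbolic angle $\varphi\ge 0$ is defined by $\cosh\varphi=\bar g(N,\partial_t)$; it is bounded if $\sup_M\varphi<\infty$. A non-compact Riemannian manifold is parabolic if it admits no non-constant positive superharmonic function. *)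

(* Defs.v *)
From HB Require Import structures.
From mathcomp Require Import all_boot all_order all_algebra.
From mathcomp Require Import all_classical all_reals all_analysis.

Set Implicit Arguments.
Unset Strict Implicit.
Unset Printing Implicit Defensive.

Import Order.TTheory GRing.Theory Num.Theory.
Import numFieldNormedType.Exports.

Local Open Scope classical_set_scope.
Local Open Scope ring_scope.

(* Conventions.  Points and tangent vectors in coordinates are row vectors;
   a linear map acts by multiplication on the right, so the differential of f
   at x is v |-> v *m jacobian f x, and the i-th row of the Jacobian is the
   image of the i-th coordinate vector. *)

Section Calculus.
Variables (R : realType) (n : nat).
Implicit Types (f : 'rV[R]_n -> R) (U : set 'rV[R]_n).

Definition partial (i : 'I_n) f : 'rV[R]_n -> R := 'D_(delta_mx 0 i) f.

Definition iter_partial (s : seq 'I_n) f : 'rV[R]_n -> R := foldr partial f s.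

Definition Ck_on (k : nat) U f : Prop :=
  forall (s : seq 'I_n) (x : 'rV[R]_n), U x -> (size s <= k)%N ->
    {for x, continuous (iter_partial s f)} /\
    ((size s < k)%N -> forall i, derivable (iter_partial s f) x (delta_mx 0 i)).

Definition smooth_on U f : Prop := forall k, Ck_on k U f.

Definition smooth_mx_on (p q : nat) U (f : 'rV[R]_n -> 'M[R]_(p, q)) : Prop :=
  forall i j, smooth_on U (fun x => f x i j).

(* Local expressions attached to a symmetric nondegenerate matrix field G,
   the matrix of a (pseudo-)Riemannian metric in a chart. *)
Variable G : 'rV[R]_n -> 'M[R]_n.

(* The Christoffel symbol Gamma^k_ij. *)
Definition christoffel (k i j : 'I_n) (x : 'rV[R]_n) : R :=
  2^-1 * \sum_l invmx (G x) k l *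
    (partial i (fun y => G y j l) x + partial j (fun y => G y i l) x
     - partial l (fun y => G y i j) x).

(* The coefficient of D_l in R(D_i, D_j) D_k, where
   R(X, Y) Z = nabla_X nabla_Y Z - nabla_Y nabla_X Z - nabla_[X, Y] Z. *)
Definition curvature (l k i j : 'I_n) (x : 'rV[R]_n) : R :=
  partial i (christoffel l j k) x - partial j (christoffel l i k) x
  + \sum_m (christoffel m j k x * christoffel l i m x
            - christoffel m i k x * christoffel l j m x).

(* Ric(Y, Z) is the trace of X |-> R(X, Y) Z. *)
Definition ricci (x : 'rV[R]_n) : 'M[R]_n :=
  \matrix_(j, k) \sum_i curvature i k i j x.

Definition laplacian f (x : 'rV[R]_n) : R :=
  \sum_i \sum_j invmx (G x) i j *
    (partial i (partial j f) x
     - \sum_k christoffel k i j x * partial k f x).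

End Calculus.

(* Smooth manifolds of dimension n, given by an atlas.  [coord c] and [para c]
   are mutually inverse homeomorphisms between the open sets [dom c] and
   [img c]; their values outside these sets are irrelevant. *)
Record manifold (R : realType) (n : nat) := Manifold {
  point :> topologicalType;
  chart : Type;
  dom : chart -> set point;
  coord : chart -> point -> 'rV[R]_n;
  para : chart -> 'rV[R]_n -> point;
  point_hausdorff : hausdorff_space point;
  point_second_countable : @second_countable point;
  dom_cover : forall p, exists c, dom c p;
  dom_open : forall c, open (dom c);
  img_open : forall c, open (coord c @` dom c);
  coordK : forall c p, dom c p -> para c (coord c p) = p;
  coord_continuous : forall c p, dom c p -> {for p, continuous (coord c)};
  para_continuous : forall c p, dom c p -> {for coord c p, continuous (para c)};
  transition_smooth : forall c c',
    smooth_mx_on (coord c @` (dom c `&` dom c')) (coord c' \o para c)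
}.

Definition img (R : realType) (n : nat) (X : manifold R n) (c : chart X) :
  set 'rV[R]_n := coord c @` dom c.

(* Symmetric positive definite smooth (0,2)-tensor fields, given by their
   matrices in the charts of the atlas. *)
Record riem_metric (R : realType) (n : nat) (X : manifold R n) := RiemMetric {
  gmx :> chart X -> 'rV[R]_n -> 'M[R]_n;
  gmx_smooth : forall c, smooth_mx_on (img c) (gmx c);
  gmx_sym : forall c x, img c x -> (gmx c x)^T = gmx c x;
  gmx_posdef : forall c x, img c x ->
    forall v : 'rV[R]_n, v != 0 -> 0 < (v *m gmx c x *m v^T) 0 0;
  gmx_change : forall c c' p, dom c p -> dom c' p ->
    let J := jacobian (coord c' \o para c) (coord c p) in
    gmx c (coord c p) = J *m gmx c' (coord c' p) *m J^T
}.

Section Riemannian.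
Variables (R : realType) (n : nat) (X : manifold R n) (g : riem_metric X).

Definition nonneg_ricci : Prop :=
  forall c x, img c x -> forall v : 'rV[R]_n,
    0 <= (v *m ricci (g c) x *m v^T) 0 0.

Definition geodesic_on (J : set R) (gamma : R -> X) : Prop :=
  forall t, J t -> {for t, continuous gamma} /\
    forall c, dom c (gamma t) ->
      let x : R -> 'rV[R]_n := coord c \o gamma in
      [/\ derivable x t 1, derivable (derive1 x) t 1 &
        forall k, derive1 (derive1 x) t 0 k
          + \sum_i \sum_j christoffel (g c) k i j (x t)
              * derive1 x t 0 i * derive1 x t 0 j = 0].

(* Geodesic completeness: every geodesic extends to the whole real line. *)
Definition complete_metric : Prop :=
  forall (J : set R) (gamma : R -> X),
    open J -> is_interval J -> J !=set0 -> geodesic_on J gamma ->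
    exists2 delta : R -> X, geodesic_on setT delta &
      forall t, J t -> delta t = gamma t.

Definition superharmonic (u : X -> R) : Prop :=
  forall c, Ck_on 2 (img c) (u \o para c) /\
    forall x, img c x -> laplacian (g c) (u \o para c) x <= 0.

Definition parabolic : Prop :=
  ~ compact [set: X] /\
  forall u : X -> R, superharmonic u -> (forall p, 0 < u p) ->
    exists k : R, forall p, u p = k.

End Riemannian.

Definition cosh (R : realType) (x : R) : R := (expR x + expR (- x)) / 2.

(* The Lorentzian product I x F, seen as an open subset of R x F, with the
   charts (t, p) |-> (t, coord c p) for c a chart of F. *)
Section LorentzianProduct.
Variables (R : realType) (n : nat) (F : manifold R n) (gF : riem_metric F).

Definition lcoord (c : chart F) (y : R * F) : 'rV[R]_(1 + n) :=
  row_mx (y.1)%:M (coord c y.2).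

Definition ltransition (c c' : chart F) (y : 'rV[R]_(1 + n)) : 'rV[R]_(1 + n) :=
  row_mx (lsubmx y) (coord c' (para c (rsubmx y))).

Definition lorentz_mx (c : chart F) (y : 'rV[R]_(1 + n)) : 'M[R]_(1 + n) :=
  block_mx (-1)%:M 0 0 (gF c (rsubmx y)).

Definition lorentz (c : chart F) (y : R * F) (v w : 'rV[R]_(1 + n)) : R :=
  (v *m lorentz_mx c (lcoord c y) *m w^T) 0 0.

Definition partial_t : 'rV[R]_(1 + n) := row_mx 1%:M 0.

Section Hypersurface.
Variables (M : manifold R n) (gM : riem_metric M) (psi : M -> R * F).

Definition overlap (a : chart M) (c : chart F) : set M :=
  dom a `&` [set p | dom c (psi p).2].

Definition lpsi (a : chart M) (c : chart F) : 'rV[R]_n -> 'rV[R]_(1 + n) :=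
  lcoord c \o psi \o para a.

Definition dpsi (a : chart M) (c : chart F) (p : M) : 'M[R]_(n, 1 + n) :=
  jacobian (lpsi a c) (coord a p).

(* psi is an immersion into I x F with induced metric gM; as gM is a
   riem_metric, the induced metric is Riemannian. *)
Definition spacelike_hypersurface (I : set R) : Prop :=
  [/\ forall p, I (psi p).1,
      continuous psi,
      forall a c, smooth_mx_on (coord a @` overlap a c) (lpsi a c),
      forall a c p, overlap a c p -> row_free (dpsi a c p) &
      forall a c p, overlap a c p ->
        gM a (coord a p) =
        dpsi a c p *m lorentz_mx c (lcoord c (psi p)) *m (dpsi a c p)^T].

(* A vector field along psi is given by its components N c p in each product
   chart c around psi p. *)
Definition vector_field_along (N : chart F -> M -> 'rV[R]_(1 + n)) : Prop :=
  (forall c c' p, dom c (psi p).2 -> dom c' (psi p).2 ->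
     N c' p = N c p *m jacobian (ltransition c c') (lcoord c (psi p))) /\
  (forall a c, smooth_mx_on (coord a @` overlap a c) (N c \o para a)).

Variable N : chart F -> M -> 'rV[R]_(1 + n).

Definition unit_normal : Prop :=
  vector_field_along N /\
  forall c p, dom c (psi p).2 ->
    [/\ forall a, dom a p -> forall v : 'rV[R]_n,
          lorentz c (psi p) (N c p) (v *m dpsi a c p) = 0,
        lorentz c (psi p) (N c p) (N c p) = -1 &
        0 < lorentz c (psi p) (N c p) partial_t].

(* Row j: components of nabla_(D_j) N for the Levi-Civita connection of the
   Lorentzian metric. *)
Definition nablaN (a : chart M) (c : chart F) (p : M) : 'M[R]_(n, 1 + n) :=
  \matrix_(j, k)
    (partial j (fun x => (N c \o para a) x 0 k) (coord a p)
     + \sum_l \sum_m christoffel (lorentz_mx c) k l m (lcoord c (psi p))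
         * dpsi a c p j l * N c p 0 m).

(* Row j: components of A D_j = - nabla_(D_j) N, which is tangent to psi, in
   the basis of coordinate vectors of M. *)
Definition shape_operator (a : chart M) (c : chart F) (p : M) : 'M[R]_n :=
  - nablaN a c p *m pinvmx (dpsi a c p).

Definition mean_curvature (a : chart M) (c : chart F) (p : M) : R :=
  - (n%:R^-1 * \tr (shape_operator a c p)).

Definition hyperbolic_angle (phi : M -> R) : Prop :=
  forall p, 0 <= phi p /\ forall c, dom c (psi p).2 ->
    cosh (phi p) = lorentz c (psi p) (N c p) partial_t.

Definition constant_mean_curvature (H : R) : Prop :=
  forall a c p, overlap a c p -> mean_curvature a c p = H.

End Hypersurface.
End LorentzianProduct.

(* Main.v *)
Require Import Defs.
From HB Require Import structures.
From mathcomp Require Import all_boot all_order all_algebra.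
From mathcomp Require Import all_classical all_reals all_analysis.
From mathcomp Require Import ring lra.

Set Implicit Arguments.
Unset Strict Implicit.
Unset Printing Implicit Defensive.

Import Order.TTheory GRing.Theory Num.Theory.
Import numFieldNormedType.Exports.

Local Open Scope classical_set_scope.
Local Open Scope ring_scope.

(** The height [tau = t o psi] satisfies [Delta tau = n H N_t] and
    [|grad tau|^2 = N_t^2 - 1], where [N_t = - cosh phi] is the [t]-component of
    the normal.  Let [C >= cosh phi] and [k = H / C^2].  Then
    [Delta (exp (k tau)) = exp (k tau) * (k n H N_t + k^2 (N_t^2 - 1))] is
    everywhere negative, because [cosh phi >= 1] gives
    [n cosh phi >= 1 > (cosh^2 phi - 1) / C^2].  So [exp (k tau)] is a
    non-constant positive superharmonic function, which parabolicity forbids. *)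

(** Both formulas for [tau] rest on the shape of the product metric: its [t]-row is minus the [t]-th
    basis row, and its Christoffel symbols with upper index [t] vanish. So the [t]-component of the
    Gauss formula has no ambient correction and its trace is the Laplacian, while the [(t, t)] entry
    of the inverse metric, split into tangential and normal parts, is the gradient identity. The
    exponential is positive whatever values [tau] takes. Giving [k] the sign of [H] makes the term
    linear in [k] negative for either sign of [H], and the factor [C^-2] keeps the quadratic term
    smaller uniformly on the hypersurface. Smoothness is given only through iterated partial
    derivatives, so differentiability and the symmetry of second partials have to be established
    before the geometry can be done in charts. *)

(** * Mean value theorem on lines and symmetry of second derivatives *)

Section DirectionalDerivatives.
Variables (R : realType) (V : normedModType R).
Implicit Types (f : V -> R) (x v w : V).

Lemma is_derive_line f x v (s : R) : derivable f (x + s *: v) v ->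
  is_derive s 1 (fun t : R => f (x + t *: v)) ('D_v f (x + s *: v)).
Proof.
move=> fv.
have E : (fun h : R => h^-1 *:
    (((fun t : R => f (x + t *: v)) \o shift s) (h *: 1) - f (x + s *: v))) =
  (fun h : R => h^-1 *: ((f \o shift (x + s *: v)) (h *: v) - f (x + s *: v))).
  apply/funext => h /=; congr (_ *: (f _ - _)).
  by rewrite [h%:A]mulr1 scalerDl addrCA.
by split; rewrite /derivable /derive E.
Qed.

Lemma mvt_line f x v (t : R) :
  (forall s : R, `|s| <= `|t| -> derivable f (x + s *: v) v) ->
  exists2 s : R, `|s| <= `|t| & f (x + t *: v) - f x = t * 'D_v f (x + s *: v).
Proof.
move=> fd; have d (s : R) : `|s| <= `|t| ->
    is_derive s 1 (fun u : R => f (x + u *: v)) ('D_v f (x + s *: v)).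
  by move/fd; exact: is_derive_line.
have c (a b : R) : (forall s, s \in `[a, b] -> `|s| <= `|t|) ->
    {within `[a, b], continuous (fun u : R => f (x + u *: v))}.
  by move=> ab; apply: derivable_within_continuous => s /ab /d [].
have [t0|t0] := leP 0 t.
  have sub (s : R) : s \in `[0, t] -> `|s| <= `|t|.
    by rewrite in_itv /= => /andP[s0 st]; rewrite !ger0_norm.
  have [s st E] := MVT_segment t0
    (fun s st => d s (sub s (subset_itv_oo_cc st))) (c _ _ sub).
  exists s; first exact: sub.
  by rewrite mulrC -[t in RHS]subr0 -E scale0r addr0.
have sub (s : R) : s \in `[t, 0] -> `|s| <= `|t|.
  by rewrite in_itv /= => /andP[s0 st]; rewrite !ler0_norm ?lerN2// ltW.
have [s st E] := MVT_segment (ltW t0)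
  (fun s st => d s (sub s (subset_itv_oo_cc st))) (c _ _ sub).
exists s; first exact: sub.
by apply: oppr_inj; rewrite opprB mulrC -mulrN -[- t]sub0r -E scale0r addr0.
Qed.

(* The left-hand side is symmetric in [v] and [w]. *)
Lemma second_difference f x v w (t e : R) :
  (forall y, `|x - y| < e -> derivable f y v /\ derivable ('D_v f) y w) ->
  `|t| * (`|v| + `|w|) < e ->
  exists2 y, `|x - y| < e &
    f (x + t *: v + t *: w) - f (x + t *: v) - (f (x + t *: w) - f x) =
    t ^+ 2 * 'D_w ('D_v f) y.
Proof.
move=> fd te.
have small (a b : R) : `|a| <= `|t| -> `|b| <= `|t| ->
    `|x - (x + a *: v + b *: w)| < e.
  move=> la lb; apply: le_lt_trans te.
  rewrite -addrA opprD addNKr normrN (le_trans (ler_normD _ _))// !normrZ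
    mulrDr.
  by rewrite lerD ?ler_wpM2r.
have small0 (a : R) : `|a| <= `|t| -> `|x - (x + a *: v)| < e.
  move=> la; rewrite -[x + a *: v]addr0 -(scale0r w).
  by apply: small => //; rewrite normr0.
(* The second difference is the increment of [g] along [v]. The mean value theorem is used twice:
   for [g] along [v], and for ['D_v f] along [w]. *)
pose g y := f (y + t *: w) - f y.
have gd (a : R) : `|a| <= `|t| -> derivable f (x + a *: v + t *: w) v /\
    is_derive (x + a *: v) v g
      ('D_v f (x + a *: v + t *: w) - 'D_v f (x + a *: v)).
  move=> la.
  have [d1 _] := fd _ (small _ _ la (lexx _)).
  have [d2 _] := fd _ (small0 _ la).
  split=> //; apply: is_deriveB; last exact/derivableP.
  have E : (fun h : R => h^-1 *:
      (((fun y => f (y + t *: w)) \o shift (x + a *: v)) (h *: v)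
         - f (x + a *: v + t *: w))) =
    (fun h : R => h^-1 *: ((f \o shift (x + a *: v + t *: w)) (h *: v)
         - f (x + a *: v + t *: w))).
    by apply/funext => h /=; congr (_ *: (f _ - _)); rewrite !addrA.
  by split; rewrite /derivable /derive E.
have [|s st Es] := @mvt_line g x v t.
  by move=> a la; have [_ []] := gd a la.
have [|s' st' Es'] := @mvt_line ('D_v f) (x + s *: v) w t.
  by move=> b lb; have [] := fd _ (small _ _ st lb).
exists (x + s *: v + s' *: w); first exact: small.
have [_ H] := gd s st.
rewrite -[LHS]/(g (x + t *: v) - g x) Es derive_val Es' mulrA.
by rewrite expr2.
Qed.

(** One second difference equals [t ^+ 2] times either mixed derivative, each taken at its own point
    near [x]. Dividing by [t ^+ 2] and using continuity at [x] puts the two mixed derivatives within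
    [e] of each other. *)
Lemma derive_swap f x v w :
  (\forall y \near x, [/\ derivable f y v, derivable f y w,
     derivable ('D_v f) y w & derivable ('D_w f) y v]) ->
  {for x, continuous ('D_w ('D_v f))} -> {for x, continuous ('D_v ('D_w f))} ->
  'D_w ('D_v f) x = 'D_v ('D_w f) x.
Proof.
move=> fd cvw cwv; apply/eqP; rewrite -subr_eq0 -normr_le0.
apply/ler_addgt0Pr => e e0; rewrite add0r.
have e20 : 0 < e / 2 by rewrite divr_gt0.
have /nbhs_normP[d d0 H] : \forall y \near x, [/\ derivable f y v,
    derivable f y w, derivable ('D_v f) y w & derivable ('D_w f) y v] /\
    (`|'D_w ('D_v f) x - 'D_w ('D_v f) y| < e / 2 /\
     `|'D_v ('D_w f) x - 'D_v ('D_w f) y| < e / 2).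
  apply: filterI => //; apply: filterI.
    by move/cvgrPdist_lt : cvw; apply.
  by move/cvgrPdist_lt : cwv; apply.
have [t t0 te] : exists2 t : R, 0 < t & `|t| * (`|v| + `|w|) < d.
  exists (d / (`|v| + `|w| + 1));
    first by rewrite divr_gt0 // ltr_wpDl ?addr_ge0.
  have P : 0 < `|v| + `|w| + 1 by rewrite ltr_wpDl ?addr_ge0.
  rewrite ger0_norm ?divr_ge0 ?ltW // mulrAC ltr_pdivrMr // ltr_pM2l //.
  by rewrite ltrDl.
have fvw y : `|x - y| < d -> derivable f y v /\ derivable ('D_v f) y w.
  by move=> /H[[]].
have fwv y : `|x - y| < d -> derivable f y w /\ derivable ('D_w f) y v.
  by move=> /H[[]].
have [y1 y1d E1] := second_difference fvw te.
have te' : `|t| * (`|w| + `|v|) < d by rewrite [_ + `|v|]addrC.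
have [y2 y2d E2] := second_difference fwv te'.
have E : 'D_w ('D_v f) y1 = 'D_v ('D_w f) y2.
  have /mulfI : t ^+ 2 != 0 by rewrite expf_neq0 // gt_eqF.
  apply; apply: etrans (esym E1) _; apply: etrans _ E2.
  have -> : x + t *: w + t *: v = x + t *: v + t *: w by exact: addrAC.
  by ring.
have [_ [h1 _]] := H _ y1d; have [_ [_ h2]] := H _ y2d.
rewrite (splitr e); apply: ltW; apply: le_lt_trans (ltrD h1 _).
  exact: ler_distD.
by rewrite E distrC.
Qed.

End DirectionalDerivatives.

(** * Continuous partial derivatives imply differentiability *)

Section ContinuousPartials.
Variables (R : realType) (n : nat).
Implicit Types (f : 'rV[R]_n -> R) (x h : 'rV[R]_n).

Lemma coord_le_norm h i : `|h 0 i| <= `|h|.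
Proof.
by rewrite [leRHS]/Num.Def.normr/= mx_normrE; exact: (le_bigmax _ _ (0, i)).
Qed.

Lemma norm_row_le h (e : R) : 0 <= e -> (forall i, `|h 0 i| <= e) -> `|h| <= e.
Proof.
move=> e0 he; rewrite /Num.Def.normr/= mx_normrE (bigmax_le _ e0)//=.
by move=> -[i j] _; rewrite ord1.
Qed.

(* Moving from [x] to [x + h] one coordinate at a time. *)
Lemma increment_error f x h (c : 'I_n -> R) (e : R) :
  (forall y, `|x - y| <= `|h| -> forall i : 'I_n,
     derivable f y (delta_mx 0 i) /\ `|c i - partial i f y| <= e) ->
  `|f (x + h) - f x - \sum_i h 0 i * c i| <= n%:R * e * `|h|.
Proof.
move=> H; pose p k : 'rV[R]_n := \row_i (if (i < k)%N then h 0 i else 0).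
have pS (i : 'I_n) : p i.+1 = p i + h 0 i *: delta_mx 0 i.
  apply/rowP => j; rewrite !mxE eqxx /= ltnS leq_eqVlt;
    have [->|ji] := eqVneq j i.
    by rewrite eqxx ltnn mulr1 add0r.
  by rewrite -(inj_eq val_inj) /= in ji; rewrite (negbTE ji) mulr0 addr0.
have pn : p n = h by apply/rowP => j; rewrite !mxE ltn_ord.
have p0 : p 0%N = 0 by apply/rowP => j; rewrite !mxE.
have -> : f (x + h) - f x = \sum_(i < n) (f (x + p i.+1) - f (x + p i)).
  rewrite -(big_mkord xpredT (fun i => f (x + p i.+1) - f (x + p i))).
  by rewrite telescope_sumr// pn p0 addr0.
rewrite -sumrB -mulrA; apply: le_trans (ler_norm_sum _ _ _) _.
have step (i : 'I_n) :
    `|f (x + p i.+1) - f (x + p i) - h 0 i * c i| <= e * `|h|.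
  (* The norm is the maximum norm, so truncating [h] and shrinking one more coordinate does not
     leave the ball of radius [|h|]. *)
  have near_p (s : R) : `|s| <= `|h 0 i| ->
      `|x - (x + p i + s *: delta_mx 0 i)| <= `|h|.
    move=> sh; rewrite -addrA opprD addNKr normrN; apply: norm_row_le => // j.
    rewrite !mxE eqxx /=; have [->|ji] := eqVneq j i.
      by rewrite ltnn add0r mulr1 (le_trans sh)// coord_le_norm.
    rewrite mulr0 addr0; case: ifP => _; first exact: coord_le_norm.
    by rewrite normr0.
  have [|s sh] := @mvt_line _ _ f (x + p i) (delta_mx 0 i) (h 0 i).
    by move=> s sh; have [] := H _ (near_p s sh) i.
  rewrite pS addrA => ->; rewrite -mulrBr normrM mulrC distrC.
  have [_ ce] := H _ (near_p s sh) i.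
  by apply: ler_pM => //; exact: coord_le_norm.
apply: le_trans (ler_sum _ (fun i _ => step i)) _.
by rewrite sumr_const card_ord mulr_natl.
Qed.

Lemma first_order_differentiable (V W : normedModType R) (f : V -> W)
    (L : {linear V -> W}) (x : V) :
  continuous L ->
  (forall e : R, 0 < e ->
     \forall h \near 0, `|f (x + h) - f x - L h| <= e * `|h|) ->
  differentiable f x.
Proof.
move=> Lc fL.
have E : f \o shift x = cst (f x) + L +o_ 0 id.
  apply/eqaddoP => e e0; apply: filterS (fL _ e0) => h.
  by rewrite !fctE opprD addrA addrC [shift x h]addrC addrC.
by apply/diff_locallyP; rewrite (diff_unique Lc E).
Qed.

Lemma continuous_partials_differentiable f x :
  (\forall y \near x, forall i : 'I_n, derivable f y (delta_mx 0 i)) ->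
  (forall i, {for x, continuous (partial i f)}) ->
  differentiable f x.
Proof.
move=> fd fc; pose c : 'cV[R]_n := \col_i partial i f x.
have Llin : linear (fun h : 'rV[R]_n => (h *m c) 0 0 : R).
  by move=> a u v; rewrite mulmxDl -scalemxAl !mxE.
pose LM := GRing.isLinear.Build _ _ _ _ _ Llin.
pose L : {linear 'rV[R]_n -> R} :=
  HB.pack (fun h : 'rV[R]_n => (h *m c) 0 0) LM.
have LE h : L h = \sum_i h 0 i * partial i f x.
  by rewrite [LHS]mxE; apply: eq_bigr => i _; rewrite mxE.
have Lc : continuous L.
  move=> h; apply: differentiable_continuous.
  rewrite (_ : L = \sum_i (fun h : 'rV[R]_n => h 0 i * partial i f x) :> (_ ->
    _)).
    apply: differentiable_sum => i.
    exact/differentiableM/differentiable_cst/differentiable_coord.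
  by apply/funext => k; rewrite LE fct_sumE.
apply: (first_order_differentiable Lc) => e e0.
(* [increment_error] sums [n] coordinate errors; dividing by [n.+1] brings the sum below [e] and
   keeps the denominator nonzero. *)
have e'0 : 0 < e / n.+1%:R by rewrite divr_gt0.
have : \forall y \near x, forall i : 'I_n, derivable f y (delta_mx 0 i) /\
    `|partial i f x - partial i f y| <= e / n.+1%:R.
  apply: (@filter_forall _ 'I_n (fun i y => derivable f y (delta_mx 0 i) /\
    `|partial i f x - partial i f y| <= e / n.+1%:R) (nbhs x) _ _) => i;
      apply: filterI.
    by apply: filterS fd => y; exact.
  by move/cvgrPdist_le : (fc i); apply.
move=> /nbhs_normP[d d0 H]; apply/nbhs_normP; exists d => //= h.
rewrite /= sub0r normrN => hd.
rewrite -[X in `|_ - X|]/(L h) LE;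
  apply: le_trans (@increment_error f x h _ (e / n.+1%:R) _) _.
  by move=> y yh; apply: H; exact: le_lt_trans hd.
rewrite ler_wpM2r// mulrCA ler_piMr ?(ltW e0)// ler_pdivrMr// mul1r.
by rewrite ler_nat.
Qed.

Lemma differentiable_rowP (V : normedModType R) (u : V -> 'rV[R]_n) (x : V) :
  (forall i, differentiable (fun y => u y 0 i) x) -> differentiable u x.
Proof.
move=> ud; rewrite (_ : u = \sum_i (fun y => u y 0 i *: delta_mx 0 i)).
  by apply: differentiable_sum => i; exact: differentiableZl.
by apply/funext => y; rewrite fct_sumE -row_sum_delta.
Qed.

End ContinuousPartials.

(** * Consequences of smoothness on an open set *)

Section SmoothFunctions.
Variables (R : realType) (n : nat).
Implicit Types (f : 'rV[R]_n -> R) (U : set 'rV[R]_n) (x : 'rV[R]_n).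

Lemma smooth_on_partial U f i : smooth_on U f -> smooth_on U (partial i f).
Proof.
(* [iter_partial] is a right fold, so the derivative taken first is the last entry of the
   sequence. *)
move=> fs k s x Ux sk; have := fs k.+1 (rcons s i) x Ux.
by rewrite size_rcons /iter_partial foldr_rcons !ltnS; exact.
Qed.

Lemma smooth_on_derivable U f x i :
  smooth_on U f -> U x -> derivable f x (delta_mx 0 i).
Proof. by move=> /(_ 1%N [::] x) fs Ux; have [_] := fs Ux isT; apply. Qed.

Lemma smooth_on_continuous U f x :
  smooth_on U f -> U x -> {for x, continuous f}.
Proof. by move=> /(_ 0%N [::] x) fs Ux; have [] := fs Ux isT. Qed.

Lemma smooth_on_differentiable U f x :
  open U -> smooth_on U f -> U x -> differentiable f x.
Proof.
move=> Uo fs Ux; apply: continuous_partials_differentiable => [|i].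
  have : nbhs x U by apply: open_nbhs_nbhs.
  by apply: filterS => y Uy i; exact: smooth_on_derivable fs Uy.
by apply: smooth_on_continuous Ux; exact: smooth_on_partial.
Qed.

Lemma partialC U f x i j : open U -> smooth_on U f -> U x ->
  partial i (partial j f) x = partial j (partial i f) x.
Proof.
move=> Uo fs Ux.
have fsi := smooth_on_partial i fs; have fsj := smooth_on_partial j fs.
apply: derive_swap.
- have : nbhs x U by apply: open_nbhs_nbhs.
  apply: filterS => y Uy.
  split; [exact: smooth_on_derivable fs Uy|exact: smooth_on_derivable fs Uy
    |exact: smooth_on_derivable fsj Uy|exact: smooth_on_derivable fsi Uy].
- by apply: smooth_on_continuous Ux; do 2!apply: smooth_on_partial.
- by apply: smooth_on_continuous Ux; do 2!apply: smooth_on_partial.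
Qed.

End SmoothFunctions.

(** * Entrywise partial derivatives of matrix fields and the chain rule *)

(** Differentiating entry by entry matches the way smoothness of matrix fields is stated. *)
HB.lock
Definition dmx (R : realType) (n p q : nat) (i : 'I_n)
    (A : 'rV[R]_n -> 'M[R]_(p, q)) (x : 'rV[R]_n) : 'M[R]_(p, q) :=
  \matrix_(a, b) partial i (fun y => A y a b) x.

Section EntrywisePartials.
Variables (R : realType) (n : nat).

Lemma dmxE (p q : nat) (i : 'I_n) (A : 'rV[R]_n -> 'M[R]_(p, q)) x a b :
  dmx i A x a b = partial i (fun y => A y a b) x.
Proof. by rewrite dmx.unlock mxE. Qed.

Lemma dmx_near (p q : nat) (i : 'I_n) (A B : 'rV[R]_n -> 'M[R]_(p, q)) x :
  (\forall y \near x, A y = B y) -> dmx i A x = dmx i B x.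
Proof.
move=> AB; apply/matrixP => a b; rewrite !dmxE; apply: near_eq_derive.
by apply: filterS AB => y ->.
Qed.

Lemma dmx_cst (p q : nat) (i : 'I_n) (A : 'M[R]_(p, q)) x :
  dmx i (fun=> A) x = 0.
Proof. by apply/matrixP => a b; rewrite dmxE mxE; exact: derive_cst. Qed.

Lemma dmx_tr (p q : nat) (i : 'I_n) (A : 'rV[R]_n -> 'M[R]_(p, q)) x :
  dmx i (fun y => (A y)^T) x = (dmx i A x)^T.
Proof.
apply/matrixP => a b; rewrite mxE !dmxE; congr (partial i _ x).
by apply/funext => y; rewrite mxE.
Qed.

Definition derivable_entries (p q : nat) (i : 'I_n)
    (A : 'rV[R]_n -> 'M[R]_(p, q)) (x : 'rV[R]_n) : Prop :=
  forall a b, derivable (fun y => A y a b) x (delta_mx 0 i).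

Lemma is_derive_mulmx (p q r : nat) (i : 'I_n) (A : 'rV[R]_n -> 'M[R]_(p, q))
    (B : 'rV[R]_n -> 'M[R]_(q, r)) x a b :
  derivable_entries i A x -> derivable_entries i B x ->
  is_derive x (delta_mx 0 i) (fun y => (A y *m B y) a b)
    ((dmx i A x *m B x + A x *m dmx i B x) a b).
Proof.
move=> dA dB.
have E : (fun y => (A y *m B y) a b) =
    \sum_(k < q) ((fun y => A y a k) * (fun y => B y k b)).
  by apply/funext => y; rewrite fct_sumE mxE.
have E' : (dmx i A x *m B x + A x *m dmx i B x) a b =
    \sum_(k < q) (A x a k *: partial i (fun y => B y k b) x +
                  B x k b *: partial i (fun y => A y a k) x).
  rewrite 3!mxE -big_split /=; apply: eq_bigr => k _.
  by rewrite !dmxE addrC [X in _ + X]mulrC.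
rewrite E E'; apply: is_derive_sum => k.
by apply: is_deriveM; apply: derivableP; [exact: dA|exact: dB].
Qed.

Lemma derivable_mulmx (p q r : nat) (i : 'I_n) (A : 'rV[R]_n -> 'M[R]_(p, q))
    (B : 'rV[R]_n -> 'M[R]_(q, r)) x :
  derivable_entries i A x -> derivable_entries i B x ->
  derivable_entries i (fun y => A y *m B y) x.
Proof. by move=> dA dB a b; have [] := is_derive_mulmx a b dA dB. Qed.

Lemma dmx_mul (p q r : nat) (i : 'I_n) (A : 'rV[R]_n -> 'M[R]_(p, q))
    (B : 'rV[R]_n -> 'M[R]_(q, r)) x :
  derivable_entries i A x -> derivable_entries i B x ->
  dmx i (fun y => A y *m B y) x = dmx i A x *m B x + A x *m dmx i B x.
Proof.
move=> dA dB; apply/matrixP => a b; rewrite dmxE.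
by have [_ E] := is_derive_mulmx a b dA dB; exact: E.
Qed.

End EntrywisePartials.

Section ChainRule.
Variables (R : realType) (n m : nat) (phi : 'rV[R]_n -> 'rV[R]_m).
Variable x : 'rV[R]_n.
Hypothesis dphi : forall l, differentiable (fun y => phi y 0 l) x.

Lemma dmxE_jacobian i : dmx i phi x = row i (jacobian phi x).
Proof.
have d : differentiable phi x by exact: differentiable_rowP.
rewrite rowE -deriveEjacobian// derive_mx; last exact: diff_derivable.
by apply/matrixP => a b; rewrite dmxE !mxE ord1.
Qed.

Lemma is_derive_comp (f : 'rV[R]_m -> R) i : differentiable f (phi x) ->
  is_derive x (delta_mx 0 i) (f \o phi)
    (\sum_l dmx i phi x 0 l * partial l f (phi x)).
Proof.
move=> df; have d : differentiable phi x by exact: differentiable_rowP.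
have dc : differentiable (f \o phi) x by exact: differentiable_comp.
split; first exact: diff_derivable.
rewrite deriveE// diff_comp//= -(deriveE _ d) derive_mx;
  last exact: diff_derivable.
rewrite (_ : \matrix_(_, _) _ = dmx i phi x); last by rewrite dmx.unlock.
rewrite [X in 'd f _ X]row_sum_delta linear_sum.
by apply: eq_bigr => l _; rewrite linearZ /= -(deriveE _ df).
Qed.

Lemma dmx_comp (p q : nat) (G : 'rV[R]_m -> 'M[R]_(p, q)) i :
  (forall a b, differentiable (fun y => G y a b) (phi x)) ->
  derivable_entries i (G \o phi) x /\
  dmx i (G \o phi) x = \sum_l dmx i phi x 0 l *: dmx l G (phi x).
Proof.
move=> dG; split=> [a b|]; first by have [] := is_derive_comp i (dG a b).
apply/matrixP => a b; rewrite dmxE summxE.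
have [_ E] := is_derive_comp i (dG a b); apply: etrans E _.
by apply: eq_bigr => l _; rewrite mxE (dmxE l G).
Qed.

End ChainRule.

(** * Christoffel symbols and compatibility with the metric *)

Section Christoffel.
Variables (R : realType) (m : nat) (G : 'rV[R]_m -> 'M[R]_m) (y : 'rV[R]_m).
Hypothesis Gsym : \forall z \near y, (G z)^T = G z.

Lemma partial_metricC l i j :
  partial l (fun z => G z i j) y = partial l (fun z => G z j i) y.
Proof.
by apply: near_eq_derive; apply: filterS Gsym => z E; rewrite -[in LHS]E mxE.
Qed.

Lemma christoffelC k i j : christoffel G k i j y = christoffel G k j i y.
Proof.
congr (_ * _); apply: eq_bigr => l _; congr (_ * (_ - _)); first exact: addrC.
exact: partial_metricC.
Qed.

(** Multiplication by [G] cancels the inverse matrix in the definition and leaves the Christoffel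
    symbols of the first kind. *)
Lemma christoffel_lower l i j : G y \in unitmx ->
  \sum_k G y l k * christoffel G k i j y =
  2^-1 * (partial i (fun z => G z j l) y + partial j (fun z => G z i l) y
          - partial l (fun z => G z i j) y).
Proof.
move=> Gu; pose v : 'cV[R]_m := \col_l
  (partial i (fun z => G z j l) y + partial j (fun z => G z i l) y
   - partial l (fun z => G z i j) y).
have -> : \sum_k G y l k * christoffel G k i j y =
    2^-1 * (G y *m (invmx (G y) *m v)) l 0.
  rewrite mxE mulr_sumr; apply: eq_bigr => k _; rewrite mulrCA;
    congr (_ * (_ * _)).
  by rewrite mxE; apply: eq_bigr => p _; rewrite mxE.
by rewrite mulKVmx// mxE.
Qed.

(* [christoffel_mx l] is the matrix of [v |-> nabla_(D_l) v] on constant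
   vector fields, acting on columns. *)
Definition christoffel_mx (l : 'I_m) : 'M[R]_m :=
  \matrix_(k, j) christoffel G k l j y.

(** The metric is parallel: of the two first-kind symbols added here, everything cancels except the
    derivative of [G] along [l]. *)
Lemma dmx_metric l : G y \in unitmx ->
  dmx l G y = G y *m christoffel_mx l + (christoffel_mx l)^T *m G y.
Proof.
move=> Gu; have Gs : (G y)^T = G y by exact: nbhs_singleton Gsym.
have -> : (christoffel_mx l)^T *m G y = (G y *m christoffel_mx l)^T.
  by rewrite trmx_mul Gs.
have E p q : (G y *m christoffel_mx l) p q =
    2^-1 * (partial l (fun z => G z q p) y + partial q (fun z => G z l p) y
            - partial p (fun z => G z l q) y).
  rewrite -christoffel_lower// mxE; apply: eq_bigr => k _.
  by rewrite mxE.
apply/matrixP => p q; rewrite [RHS]mxE [X in _ + X]mxE !E dmxE.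
rewrite (partial_metricC l q p).
set a := partial l _ _; set b := partial q _ _; set c := partial p _ _.
by field.
Qed.

End Christoffel.

(* The covariant derivative along [phi] in the direction [i] of the vector
   field [v] with components in the coordinates of the target. *)
HB.lock
Definition covd (R : realType) (n m : nat) (G : 'rV[R]_m -> 'M[R]_m)
    (phi : 'rV[R]_n -> 'rV[R]_m) (i : 'I_n) (v : 'rV[R]_n -> 'rV[R]_m)
    (x : 'rV[R]_n) : 'rV[R]_m :=
  dmx i v x +
  v x *m (\sum_l dmx i phi x 0 l *: christoffel_mx G (phi x) l)^T.

(** * Covariant derivative along a map: metric and torsion-free *)

Section AlongMap.
Variables (R : realType) (n m : nat) (G : 'rV[R]_m -> 'M[R]_m).
Variables (phi : 'rV[R]_n -> 'rV[R]_m) (x : 'rV[R]_n).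

Lemma covdE i v k : covd G phi i v x 0 k = partial i (fun z => v z 0 k) x +
  \sum_l \sum_p christoffel G k l p (phi x) * dmx i phi x 0 l * v x 0 p.
Proof.
rewrite covd.unlock 2!mxE dmxE; congr (_ + _); rewrite exchange_big;
  apply: eq_bigr => p _ /=.
rewrite mxE summxE mulr_sumr; apply: eq_bigr => l _.
by rewrite !mxE mulrC [X in X * _]mulrC.
Qed.

Hypothesis Gsym : \forall z \near phi x, (G z)^T = G z.
Hypothesis Gunit : G (phi x) \in unitmx.
Hypothesis Gdiff : forall a b, differentiable (fun z => G z a b) (phi x).
Hypothesis dphi : forall l, differentiable (fun y => phi y 0 l) x.

(** The product rule leaves a term with the derivative of [G] along [phi]; by [dmx_metric] it
    consists of exactly the two Christoffel terms that turn [dmx] of [v] and [w] into [covd]. *)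
Lemma covd_metric i (v w : 'rV[R]_n -> 'rV[R]_m) :
  derivable_entries i v x -> derivable_entries i w x ->
  dmx i (fun z => v z *m G (phi z) *m (w z)^T) x =
  covd G phi i v x *m G (phi x) *m (w x)^T + v x *m G (phi x) *m (covd G phi i
    w x)^T.
Proof.
move=> dv dw; have [dG EG] := dmx_comp dphi i Gdiff.
have dw' : derivable_entries i (fun z => (w z)^T) x.
  move=> a b; rewrite (_ : (fun _ => _) = (fun z => w z b a)); first exact: dw.
  by apply/funext => z; rewrite mxE.
rewrite (dmx_mul (derivable_mulmx dv dG) dw') dmx_tr (dmx_mul dv dG) EG
  covd.unlock.
set C := \sum_l _ *: christoffel_mx _ _ _.
have -> : \sum_l dmx i phi x 0 l *: dmx l G (phi x) =
    G (phi x) *m C + C^T *m G (phi x).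
  rewrite mulmx_sumr raddf_sum mulmx_suml -big_split; apply: eq_bigr => l _ /=.
  by rewrite dmx_metric// scalerDr -scalemxAr [(_ *: _)^T]linearZ -scalemxAl.
rewrite [(_ + _)^T]raddfD /= trmx_mul trmxK !(mulmxDl, mulmxDr) !mulmxA.
by rewrite -!addrA; congr (_ + _); rewrite addrC -addrA.
Qed.

Lemma covd_torsion_free i j :
  dmx i (dmx j phi) x = dmx j (dmx i phi) x ->
  covd G phi i (dmx j phi) x = covd G phi j (dmx i phi) x.
Proof.
move=> Eij; apply/rowP => k; rewrite !covdE -!dmxE Eij; congr (_ + _).
rewrite exchange_big; apply: eq_bigr => l _; apply: eq_bigr => p _ /=.
by rewrite (christoffelC Gsym) mulrAC.
Qed.

End AlongMap.

(** * Linear algebra of a tangent frame with a unit timelike normal *)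

Section AdaptedFrame.
Variables (K : fieldType) (n : nat).
Variables (E : 'M[K]_(n, 1 + n)) (G : 'M[K]_(1 + n)) (nu : 'rV[K]_(1 + n)).
Let g := E *m G *m E^T.
Hypothesis Gsym : G^T = G.
Hypothesis gunit : g \in unitmx.
Hypothesis nuE : nu *m G *m E^T = 0.
Hypothesis nu1 : nu *m G *m nu^T = -1%:M.

(* [G] is block diagonal in the basis formed by [nu] and the rows of [E]. *)
Lemma frame_decomposition :
  G *m E^T *m invmx g *m E - G *m nu^T *m nu = 1%:M.
Proof.
pose P := col_mx nu E; pose Q := row_mx (- nu^T) (E^T *m invmx g).
have Enu : E *m G *m nu^T = 0.
  by apply: trmx_inj; rewrite !trmx_mul trmxK Gsym mulmxA nuE trmx0.
have PQ : P *m (G *m Q) = 1%:M.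
  rewrite /P /Q mul_mx_row mul_col_row scalar_mx_block.
  rewrite !mulmxN !mulmxA nu1 Enu nuE mul0mx opprK oppr0 /g mulmxV//.
(* A right inverse of a square matrix is a left inverse; the reversed product is the claim. *)
have := mulmx1C PQ; rewrite /P /Q mul_mx_row mul_row_col mulmxN mulNmx addrC.
by rewrite mulmxA.
Qed.

Lemma frame_inverse : G *m (E^T *m invmx g *m E - nu^T *m nu) = 1%:M.
Proof. by rewrite mulmxBr !mulmxA frame_decomposition. Qed.

Lemma row_decomposition (w : 'rV[K]_(1 + n)) :
  w = w *m G *m E^T *m invmx g *m E - (w *m G *m nu^T) 0 0 *: nu.
Proof.
rewrite -[LHS]mulmx1 -frame_decomposition mulmxBr !mulmxA; congr (_ - _).
by rewrite {1}[w *m G *m nu^T]mx11_scalar mul_scalar_mx.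
Qed.

Variables (row_freeE : row_free E) (V : 'M[K]_(n, 1 + n)).
Variables (W : 'I_n -> 'I_n -> 'rV[K]_(1 + n)).
Variables (Gam : 'I_n -> 'I_n -> 'I_n -> K).
Hypothesis V_tangent : V *m G *m nu^T = 0.
Hypothesis W_normal : forall i j,
  (W i j *m G *m nu^T) 0 0 = - (V *m G *m E^T) i j.
Hypothesis W_tangent : forall i j l,
  (W i j *m G *m E^T) 0 l = \sum_k g l k * Gam k i j.

(** [pinvmx E] recovers coefficients only for rows in the span of [E]; [V_tangent] puts the rows of
    [V] there, so the metric projection gives the same coefficients. *)
Lemma tangent_coefficients : V *m pinvmx E = V *m G *m E^T *m invmx g.
Proof.
have {1}-> : V = V *m G *m E^T *m invmx g *m E.
  rewrite -[LHS]mulmx1 -frame_decomposition mulmxBr !mulmxA V_tangent.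
  by rewrite mul0mx subr0.
by rewrite mulmxKp.
Qed.

(** Since [g] is invertible, [W_tangent] identifies the tangential coefficients of [W i j] with
    [Gam]. Only the normal part, the second fundamental form, survives. *)
Lemma gauss_formula i j :
  W i j - \sum_k Gam k i j *: row k E = (V *m G *m E^T) i j *: nu.
Proof.
rewrite [W i j in LHS]row_decomposition W_normal scaleNr opprK.
have -> : W i j *m G *m E^T = (\row_k Gam k i j) *m g.
  have gs : g^T = g by rewrite /g !trmx_mul trmxK Gsym mulmxA.
  apply/rowP => l; rewrite W_tangent mxE; apply: eq_bigr => k _.
  by rewrite [X in _ = X * _]mxE mulrC -[in LHS]gs [g^T _ _]mxE.
rewrite mulmxK//; apply/eqP; rewrite subr_eq addrC; apply/eqP; congr (_ + _).
rewrite -[LHS]/(_ *m E) (mulmx_sum_row _ E).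
by apply: eq_bigr => k _; rewrite mxE.
Qed.

(** Read in component [l], the left side becomes a Laplacian and the trace on the right becomes
    [n H]. *)
Lemma trace_gauss_formula (l : 'I_(1 + n)) :
  \sum_i \sum_j invmx g i j * (W i j 0 l - \sum_k Gam k i j * E k l) =
  \tr (V *m pinvmx E) * nu 0 l.
Proof.
rewrite tangent_coefficients /mxtrace mulr_suml; apply: eq_bigr => i _.
rewrite mxE mulr_suml; apply: eq_bigr => j _.
have -> : W i j 0 l - \sum_k Gam k i j * E k l = (V *m G *m E^T) i j * nu 0 l.
  have /rowP/(_ l) := gauss_formula i j; rewrite 3!mxE summxE => <-.
  by congr (_ - _); apply: eq_bigr => k _; rewrite !mxE.
have gis : (invmx g)^T = invmx g by rewrite trmx_inv /g !trmx_mul trmxK Gsym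
  mulmxA.
by rewrite -[in LHS]gis mxE mulrA [_ * (_ *m _) _ _]mulrC.
Qed.

End AdaptedFrame.

Section SmoothMatrices.
Variables (R : realType) (n p q : nat) (U : set 'rV[R]_n).
Implicit Types A : 'rV[R]_n -> 'M[R]_(p, q).

Lemma smooth_mx_dmx A i : smooth_mx_on U A -> smooth_mx_on U (dmx i A).
Proof.
move=> As a b; rewrite (_ : (fun _ => _) = partial i (fun y => A y a b)).
  exact: smooth_on_partial.
by apply/funext => y; rewrite dmxE.
Qed.

Lemma smooth_mx_derivable A i x :
  smooth_mx_on U A -> U x -> derivable_entries i A x.
Proof. by move=> As Ux a b; exact: smooth_on_derivable (As a b) Ux. Qed.

Lemma dmxC A x i j : open U -> smooth_mx_on U A -> U x ->
  dmx i (dmx j A) x = dmx j (dmx i A) x.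
Proof.
move=> Uo As Ux; apply/matrixP => a b; rewrite !dmxE.
have E k : (fun y => dmx k A y a b) = partial k (fun y => A y a b).
  by apply/funext => y; rewrite dmxE.
by rewrite !E; exact: partialC Uo (As a b) Ux.
Qed.

End SmoothMatrices.

Lemma entry_row (K : pzSemiRingType) (p q m : nat) (A : 'M[K]_(p, m)) (B :
  'M[K]_m)
    (C : 'M[K]_(q, m)) i j :
  (A *m B *m C^T) i j = (row i A *m B *m (row j C)^T) 0 0.
Proof.
rewrite -row_mul mxE [RHS]mxE; apply: eq_bigr => k _.
by rewrite [row i _ _ _]mxE [C^T _ _]mxE [_^T k 0]mxE [row j _ _ _]mxE.
Qed.

(** * Laplacian and gradient of a coordinate function on a hypersurface *)

Section HypersurfaceInCoordinates.
Variables (R : realType) (n : nat) (U : set 'rV[R]_n).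
Variables (phi nu : 'rV[R]_n -> 'rV[R]_(1 + n)) (g : 'rV[R]_n -> 'M[R]_n).
Variables (G : 'rV[R]_(1 + n) -> 'M[R]_(1 + n)) (x : 'rV[R]_n).
Local Notation E := (jacobian phi).
Hypotheses (Uopen : open U) (Ux : U x).
Hypotheses (phi_smooth : smooth_mx_on U phi) (nu_smooth : smooth_mx_on U nu).
Hypothesis gE : forall y, U y -> g y = E y *m G (phi y) *m (E y)^T.
Hypothesis nuE : forall y, U y -> nu y *m G (phi y) *m (E y)^T = 0.
Hypothesis nu1 : forall y, U y -> nu y *m G (phi y) *m (nu y)^T = -1%:M.
Hypothesis Gsym : \forall z \near phi x, (G z)^T = G z.
Hypothesis Gdiff : forall a b, differentiable (fun z => G z a b) (phi x).
Hypothesis gunit : g x \in unitmx.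
Hypothesis row_freeE : row_free (E x).

Let Unear : \forall y \near x, U y.
Proof. exact: open_nbhs_nbhs. Qed.

Let Gs : (G (phi x))^T = G (phi x).
Proof. exact: nbhs_singleton Gsym. Qed.

Let gunit' : E x *m G (phi x) *m (E x)^T \in unitmx.
Proof. by rewrite -gE. Qed.

Lemma hypersurface_ambient_inverse :
  G (phi x) *m ((E x)^T *m invmx (g x) *m E x - (nu x)^T *m nu x) = 1%:M.
Proof. by rewrite gE//; exact: frame_inverse (nuE Ux) (nu1 Ux). Qed.

Let Gunit : G (phi x) \in unitmx.
Proof. by have [] := mulmx1_unit hypersurface_ambient_inverse. Qed.

Let dphi y l : U y -> differentiable (fun y => phi y 0 l) y.
Proof. by move=> Uy; exact: smooth_on_differentiable (phi_smooth 0 l) Uy. Qed.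

(** [W i j] is the ambient covariant derivative of the [j]-th coordinate vector, and row [i] of [V]
    is that of the normal; they instantiate the [W] and [V] of the adapted frame. *)
Let W i j := covd G phi i (dmx j phi) x.
Let V : 'M[R]_(n, 1 + n) := \matrix_i covd G phi i nu x.

Let WC i j : W i j = W j i.
Proof. by apply: covd_torsion_free => //; exact: dmxC phi_smooth Ux. Qed.

Let rowE y j : U y -> row j (E y) = dmx j phi y.
Proof. by move=> Uy; rewrite dmxE_jacobian// => l; exact: dphi. Qed.

Let metric i := covd_metric Gsym Gunit Gdiff (fun l => dphi l Ux) (i := i).

Let pairingC (v w : 'rV[R]_(1 + n)) :
  v *m G (phi x) *m w^T = w *m G (phi x) *m v^T.
Proof.
by rewrite [LHS]mx11_scalar -tr_scalar_mx -mx11_scalar !trmx_mul trmxK Gs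
  mulmxA.
Qed.

Let partial_g i j l : partial i (fun z => g z j l) x =
  (W i j *m G (phi x) *m (dmx l phi x)^T) 0 0 +
  (W i l *m G (phi x) *m (dmx j phi x)^T) 0 0.
Proof.
have dE k k' : derivable_entries k (dmx k' phi) x.
  by apply: smooth_mx_derivable Ux; exact: smooth_mx_dmx.
rewrite [X in _ + X](_ : _ = (dmx j phi x *m G (phi x) *m (W i l)^T) 0 0);
  last first.
  by rewrite pairingC.
have := congr1 (fun A : 'M[R]_1 => A 0 0) (metric (dE i j) (dE i l)).
move=> /= H; apply: etrans (etrans H _); last by rewrite mxE.
rewrite dmxE; apply: near_eq_derive.
apply: filterS Unear => z Uz.
by rewrite gE// entry_row !rowE.
Qed.

(** Koszul's argument: in the combination of three derivatives of [g], the symmetry of [W] cancels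
    all but one product. *)
Let W_tangent i j l : (W i j *m G (phi x) *m (E x)^T) 0 l =
  \sum_k (E x *m G (phi x) *m (E x)^T) l k * christoffel g k i j x.
Proof.
rewrite -gE// christoffel_lower// !partial_g entry_row row_id rowE//.
rewrite (WC j i) (WC l i) (WC l j).
set a := (W i j *m _ *m _) 0 0; set b := (W i l *m _ *m _) 0 0.
set c := (W j l *m _ *m _) 0 0.
by field.
Qed.

(** Obtained by differentiating the orthogonality of [nu] and the [j]-th coordinate vector. *)
Let W_normal i j : (W i j *m G (phi x) *m (nu x)^T) 0 0 =
  - (V *m G (phi x) *m (E x)^T) i j.
Proof.
have dn : derivable_entries i nu x by exact: smooth_mx_derivable nu_smooth Ux.
have dE : derivable_entries i (dmx j phi) x.
  by apply: smooth_mx_derivable Ux; exact: smooth_mx_dmx.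
have := metric dn dE; rewrite (@dmx_near _ _ _ _ _ _ (fun=> 0)); last first.
  apply: filterS Unear => z Uz; apply/matrixP => a b; rewrite !ord1 -rowE//.
  by rewrite -(row_id 0 (nu z)) -entry_row nuE// mxE mxE.
rewrite dmx_cst [nu x *m _ *m _]pairingC => /matrixP/(_ 0 0)/esym H.
move: H; set A := _ *m _ *m _; set B := _ *m _ *m _ => H.
have {H} /eqP : A 0 0 + B 0 0 = 0 by move: H; rewrite !mxE.
rewrite addrC addr_eq0 => /eqP ->; congr (- _).
by rewrite [RHS]entry_row [row i V]rowK rowE.
Qed.

Let V_tangent : V *m G (phi x) *m (nu x)^T = 0.
Proof.
have dn i : derivable_entries i nu x by exact: smooth_mx_derivable nu_smooth Ux.
apply/matrixP => i k; rewrite ord1 [RHS]mxE entry_row [row i V]rowK row_id.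
have := metric (dn i) (dn i); rewrite (@dmx_near _ _ _ _ _ _ (fun=> -1%:M));
  last first.
  by apply: filterS Unear => z Uz; exact: nu1.
rewrite dmx_cst [nu x *m _ *m _]pairingC => /matrixP/(_ 0 0)/esym H.
move: H; set A := _ *m _ *m _ => H.
have {H} /eqP : A 0 0 + A 0 0 = 0 by move: H; rewrite !mxE.
rewrite -mulr2n -mulr_natr mulf_eq0 pnatr_eq0 orbF.
by move/eqP.
Qed.

(** Vanishing symbols with upper index [l] make component [l] of [W i j] an ordinary second partial
    derivative, so the traced Gauss formula applies. *)
Lemma hypersurface_laplacian l :
  (forall i j, christoffel G l i j (phi x) = 0) ->
  laplacian g (fun y => phi y 0 l) x = \tr (V *m pinvmx (E x)) * nu x 0 l.
Proof.
move=> Gam0.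
rewrite -(trace_gauss_formula Gs gunit' (nuE Ux) (nu1 Ux) row_freeE V_tangent
  W_normal W_tangent) -gE//.
apply: eq_bigr => i _; apply: eq_bigr => j _; congr (_ * (_ - _)).
  rewrite /W covdE [X in _ = _ + X]big1 ?addr0 => [|k _].
    by congr (partial i _ x); apply/funext => y; rewrite dmxE.
  by rewrite big1// => p _; rewrite Gam0 !mul0r.
apply: eq_bigr => k _; congr (_ * _).
by have /rowP/(_ l) := rowE k Ux; rewrite mxE dmxE.
Qed.

(** This is the [(l, l)] entry of [hypersurface_ambient_inverse], where row [l] of [G] only
    contributes a sign. *)
Lemma hypersurface_gradient l :
  (forall k, G (phi x) l k = - (l == k)%:R) ->
  \sum_i \sum_j invmx (g x) i j *
    (partial i (fun y => phi y 0 l) x * partial j (fun y => phi y 0 l) x) =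
  nu x 0 l ^+ 2 - 1.
Proof.
move=> Gl.
have dE i : partial i (fun y => phi y 0 l) x = E x i l.
  by have /rowP/(_ l) := rowE i Ux; rewrite mxE dmxE.
have /matrixP/(_ l l) := hypersurface_ambient_inverse.
rewrite [RHS]mxE eqxx mxE (bigD1 l)//= big1 => [|k kl]; last first.
  by rewrite Gl eq_sym (negbTE kl) oppr0 mul0r.
rewrite Gl eqxx addr0 mulN1r => /(congr1 -%R);
  rewrite opprK mxE [X in _ + X]mxE.
rewrite [X in _ - X]mxE big_ord1 mxE => /eqP; rewrite subr_eq => /eqP H.
apply: etrans (etrans H _); last by rewrite mxE expr2 addrC.
under [RHS]eq_bigr do rewrite mxE mulr_suml.
rewrite exchange_big /=; apply: eq_bigr => i _; apply: eq_bigr => j _.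
by rewrite !dE [(E x)^T _ _]mxE; ring.
Qed.

End HypersurfaceInCoordinates.

(** * Derivatives and Laplacian of the exponential of a smooth function *)

Section ExponentialOfSmooth.
Variables (R : realType) (n : nat) (U : set 'rV[R]_n) (tau : 'rV[R]_n -> R) (k
  : R).
Hypotheses (Uopen : open U) (tau_smooth : smooth_on U tau).
Let u y := expR (k * tau y).

Lemma near_eq_continuous (T : topologicalType) (f h : T -> R) (x : T) :
  (\forall y \near x, f y = h y) -> {for x, continuous f} ->
  {for x, continuous h}.
Proof.
move=> fh fc; rewrite /prop_for /continuous_at -(nbhs_singleton fh).
exact: cvg_trans (near_eq_cvg fh) fc.
Qed.

Let Unear x : U x -> \forall y \near x, U y.
Proof. by move=> Ux; exact: open_nbhs_nbhs. Qed.

Let dtau x : U x -> differentiable tau x.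
Proof. by move=> Ux; exact: smooth_on_differentiable Uopen tau_smooth Ux. Qed.

Let dktau x : U x -> differentiable (fun y => k * tau y) x.
Proof. by move=> Ux; apply: differentiableM => //; exact: dtau. Qed.

Let du x : U x -> differentiable u x.
Proof.
move=> Ux; apply: (@differentiable_comp _ _ _ _ _ expR); first exact: dktau.
exact/derivable1_diffP/derivable_expR.
Qed.

(** Closed forms such as [p] are proved equal to the partials of [u] only on [U]; openness of [U]
    lets them be substituted under a further derivative. *)
Let p i y := k * (u y * partial i tau y).

Let dptau i x : U x -> differentiable (partial i tau) x.
Proof.
move=> Ux.
exact: smooth_on_differentiable Uopen (smooth_on_partial i tau_smooth) Ux.
Qed.

Let dp i x : U x -> differentiable (p i) x.
Proof.
move=> Ux; apply: differentiableM => //.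
by apply: differentiableM; [exact: du|exact: dptau].
Qed.

Let partial_u i x : U x -> partial i u x = p i x.
Proof.
move=> Ux; rewrite /partial (deriveE _ (du Ux)).
rewrite (@diff_comp _ _ _ _ _ expR _ (dktau Ux)); last first.
  exact/derivable1_diffP/derivable_expR.
rewrite /= deriv1E; last exact: derivable_expR.
have -> : derive1 expR (k * tau x) = u x by rewrite derive1E derive_val.
rewrite -(deriveE _ (dktau Ux)) deriveMl; last first.
  exact/diff_derivable/dtau.
exact: etrans (mulrC _ _) (mulrCA _ _ _).
Qed.

Let q i j y := k * (u y * partial i (partial j tau) y
  + partial j tau y * (k * (u y * partial i tau y))).

Let partial2_u i j x : U x -> partial i (partial j u) x = q i j x.
Proof.
move=> Ux; rewrite (_ : partial i (partial j u) x = partial i (p j) x);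
  last first.
  by apply: near_eq_derive; apply: filterS (Unear Ux) => y; exact: partial_u.
have d1 := diff_derivable (v := delta_mx 0 i) (du Ux).
have d2 := diff_derivable (v := delta_mx 0 i) (dptau j Ux).
apply: etrans (deriveMl _ (derivableM d1 d2)) _; congr (_ * _).
apply: etrans (deriveM d1 d2) _.
by have -> : 'D_(delta_mx 0 i) u x = p i x by exact: partial_u.
Qed.

Lemma exp_C2 : Ck_on 2 U u.
Proof.
move=> s x Ux; case: s => [_|i [_|j [_|//]]].
- split=> [|_ i]; first exact/differentiable_continuous/du.
  exact/diff_derivable/du.
- have E : \forall y \near x, p i y = partial i u y.
    by apply: filterS (Unear Ux) => y Uy; rewrite partial_u.
  split=> [|_ j].
    by apply: near_eq_continuous E _; exact/differentiable_continuous/dp.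
  by apply: near_eq_derivable E _; exact/diff_derivable/dp.
- split=> //; have E : \forall y \near x, q i j y = partial i (partial j u) y.
    by apply: filterS (Unear Ux) => y Uy; rewrite partial2_u.
  apply: near_eq_continuous E _; apply: differentiable_continuous.
  apply: differentiableM => //; apply: differentiableD.
    apply: differentiableM; first exact: du.
    exact: smooth_on_differentiable Uopen
      (smooth_on_partial i (smooth_on_partial j tau_smooth)) Ux.
  by apply: differentiableM; [exact: dptau|exact: dp].
Qed.

Lemma laplacian_exp (g : 'rV[R]_n -> 'M[R]_n) x : U x ->
  laplacian g u x = u x * (k * laplacian g tau x + k ^+ 2 *
    \sum_i \sum_j invmx (g x) i j * (partial i tau x * partial j tau x)).
Proof.
move=> Ux; rewrite mulrDr !mulr_sumr -big_split; apply: eq_bigr => i _ /=.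
rewrite !mulr_sumr -big_split; apply: eq_bigr => j _ /=.
rewrite (partial2_u i j Ux) /q.
have -> : \sum_l christoffel g l i j x * partial l u x =
    k * u x * \sum_l christoffel g l i j x * partial l tau x.
  rewrite mulr_sumr; apply: eq_bigr => l _; rewrite (partial_u l Ux) /p.
  by ring.
by ring.
Qed.

End ExponentialOfSmooth.

Lemma derive_invariant (R : realType) (V W : normedModType R) (f : V -> W)
    (x v : V) :
  (forall h : R, f (h *: v + x) = f x) -> 'D_v f x = 0.
Proof.
move=> fv; rewrite /derive (_ : (fun _ => _) = cst 0); first exact: lim_cst.
by apply/funext => h /=; rewrite fv subrr scaler0.
Qed.

Lemma posdef_unitmx (R : realFieldType) (n : nat) (A : 'M[R]_n) :
  (forall v : 'rV[R]_n, v != 0 -> 0 < (v *m A *m v^T) 0 0) -> A \in unitmx.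
Proof.
move=> Apos; rewrite -row_free_unit; apply: inj_row_free => v vA0.
apply/eqP; apply: contraT => /Apos.
by rewrite vA0 mul0mx mxE ltxx.
Qed.

(** * The product metric and its parallel time direction *)

Section LorentzianProductMetric.
Variables (R : realType) (n : nat) (F : manifold R n) (gF : riem_metric F).
Variables (c : chart F) (y : 'rV[R]_(1 + n)).
Local Notation G := (lorentz_mx gF c).
Local Notation t0 := (lshift n (ord0 : 'I_1)).
Hypothesis cy : img c (rsubmx y).

Lemma lorentz_mx_rowt z k : G z t0 k = - (t0 == k)%:R.
Proof.
case: (split_ordP k) => j ->.
  by rewrite block_mxEul !ord1 !mxE eqxx.
by rewrite block_mxEur mxE eq_lrshift oppr0.
Qed.

Lemma lorentz_mx_colt z k : G z k t0 = - (t0 == k)%:R.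
Proof.
case: (split_ordP k) => j ->.
  by rewrite block_mxEul !ord1 !mxE eqxx.
by rewrite block_mxEdl mxE eq_lrshift oppr0.
Qed.

Lemma near_img_rsubmx : \forall z \near y, img c (rsubmx z).
Proof.
have : nbhs (rsubmx y) (img c) by apply: open_nbhs_nbhs; split=> //;
  exact: img_open.
exact: (@continuous_rsubmx _ _ _ _ y).
Qed.

Lemma lorentz_mx_sym : \forall z \near y, (G z)^T = G z.
Proof.
apply: filterS near_img_rsubmx => z cz.
by rewrite tr_block_mx !trmx0 tr_scalar_mx gmx_sym.
Qed.

Lemma lorentz_mx_differentiable a b : differentiable (fun z => G z a b) y.
Proof.
case: (split_ordP a) => i ->; first last.
  case: (split_ordP b) => j ->.
    rewrite (_ : (fun _ => _) = cst 0); first exact: differentiable_cst.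
    by apply/funext => z; rewrite block_mxEdl mxE.
  rewrite (_ : (fun _ => _) = (fun z => gF c z i j) \o rsubmx); last first.
    by apply/funext => z; rewrite block_mxEdr.
  apply: differentiable_comp; first exact: differentiable_rsubmx.
  have gs : smooth_on (img c) (fun z => gF c z i j) by exact: gmx_smooth.
  have Uo : open (img c) by exact: img_open.
  exact: smooth_on_differentiable Uo gs cy.
rewrite ord1 (_ : (fun _ => _) = cst (- (t0 == b)%:R)).
  exact: differentiable_cst.
by apply/funext => z; rewrite lorentz_mx_rowt.
Qed.

Lemma invmx_lorentz_rowt k : k != t0 -> invmx (G y) t0 k = 0.
Proof.
move=> kt; have [Gu|Gn] := boolP (G y \in unitmx); last first.
  (* [invmx] returns a singular matrix unchanged, and the [t]-row of [G] already has the required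
     zeros. *)
  by rewrite /invmx (negbTE Gn) lorentz_mx_rowt eq_sym (negbTE kt) oppr0.
have /matrixP/(_ t0 k) := mulmxV Gu.
rewrite [LHS]mxE (bigD1 t0)//= big1 => [|l lt]; last first.
  by rewrite lorentz_mx_rowt eq_sym (negbTE lt) oppr0 mul0r.
rewrite lorentz_mx_rowt eqxx addr0 mulN1r mxE eq_sym (negbTE kt).
by move/eqP; rewrite oppr_eq0 => /eqP.
Qed.

(** Only the summand [l = t] survives; there two derivatives fall on the constant [t]-column, and
    the third is a [t]-derivative of a metric that does not depend on [t]. *)
Lemma lorentz_christoffel_t i j : christoffel G t0 i j y = 0.
Proof.
rewrite /christoffel big1 ?mulr0// => l _.
have [->|lt] := eqVneq l t0; last by rewrite invmx_lorentz_rowt// mul0r.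
have Dt a b : partial a (fun z => G z b t0) y = 0.
  rewrite (_ : (fun _ => _) = cst (- (t0 == b)%:R)); first exact: derive_cst.
  by apply/funext => z; rewrite lorentz_mx_colt.
rewrite !Dt addr0 sub0r.
have -> : partial t0 (fun z => G z i j) y = 0; last by rewrite oppr0 mulr0.
apply: derive_invariant => h; rewrite /lorentz_mx.
suff -> : rsubmx (h *: delta_mx 0 t0 + y) = rsubmx y by [].
by apply/rowP => k; rewrite !mxE eqxx eq_rlshift mulr0 add0r.
Qed.

End LorentzianProductMetric.

(** * The height function of a spacelike hypersurface *)

Section HypersurfaceInProduct.
Variables (R : realType) (n : nat) (F : manifold R n) (gF : riem_metric F).
Variables (I : set R) (M : manifold R n) (gM : riem_metric M) (psi : M -> R *
  F).
Variables (N : chart F -> M -> 'rV[R]_(1 + n)) (H : R).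
Hypothesis n_gt0 : (0 < n)%N.
Hypothesis psi_hyp : spacelike_hypersurface gF gM psi I.
Hypothesis N_normal : unit_normal gF psi N.
Hypothesis cmc : constant_mean_curvature gF psi N H.
Local Notation t0 := (lshift n (ord0 : 'I_1)).
Local Notation height a := (fun y => (psi (para a y)).1).

(** Near [coord a p], continuity of [para a] keeps points over the overlap, and openness of the
    chart image makes each of them a genuine coordinate vector. *)
Lemma open_overlap_image (a : chart M) (c : chart F) :
  open (Defs.coord a @` overlap psi a c).
Proof.
have [_ psic _ _ _] := psi_hyp.
rewrite openE => _ [p [ap cp] <-]; rewrite /interior.
have Oo : open (overlap psi a c).
  apply: openI; first exact: dom_open.
  have cont : continuous (snd \o psi).
    by move=> q; apply: continuous_comp; [exact: psic|case: (psi q) => ? ?;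
      exact: cvg_snd].
  by move/continuousP: cont; apply; exact: dom_open.
have n1 : \forall y \near Defs.coord a p, overlap psi a c (para a y).
  apply: (para_continuous ap); rewrite coordK//.
  by apply: open_nbhs_nbhs; split.
have n2 : \forall y \near Defs.coord a p, img a y.
  by apply: open_nbhs_nbhs; split; [exact: img_open|exists p].
by apply: filterS2 n1 n2 => y + [q aq qy]; rewrite -qy coordK//; exists q.
Qed.

Lemma heightE (a : chart M) (c : chart F) :
  height a = (fun y => lpsi psi a c y 0 t0).
Proof. by apply/funext => y; rewrite /lpsi /lcoord /= row_mxEl mxE eqxx mulr1n.
  Qed.

(** Smoothness is checked point by point, so the fiber chart may vary: the time component is the
    same in all product charts. *)
Lemma height_smooth (a : chart M) : smooth_on (img a) (height a).
Proof.
move=> k s _ [p ap <-] sk; have [c cp] := dom_cover (psi p).2.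
have [_ _ smooth _ _] := psi_hyp.
by rewrite (heightE a c); apply: smooth => //; exists p.
Qed.

Section AtPoint.
Variables (a : chart M) (c : chart F) (p : M).
Hypothesis acp : overlap psi a c p.
Local Notation x := (Defs.coord a p).
Local Notation phi := (lpsi psi a c).
Local Notation nu := (N c \o para a).

Let ap : dom a p. Proof. by have [] := acp. Qed.

Let cp : dom c (psi p).2. Proof. by have [] := acp. Qed.

Let Ux : (Defs.coord a @` overlap psi a c) x.
Proof. by exists p. Qed.

Let Uo : open (Defs.coord a @` overlap psi a c).
Proof. exact: open_overlap_image. Qed.

Let phiE q : dom a q -> phi (Defs.coord a q) = lcoord c (psi q).
Proof. by move=> aq; rewrite /lpsi /= coordK. Qed.

Let cphi : img c (rsubmx (phi x)).
Proof.
by rewrite phiE// row_mxKr; exists (psi p).2.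
Qed.

Let phi_smooth : smooth_mx_on (Defs.coord a @` overlap psi a c) phi.
Proof. by have [_ _ smooth _ _] := psi_hyp; exact: smooth. Qed.

Let nu_smooth : smooth_mx_on (Defs.coord a @` overlap psi a c) nu.
Proof. by have [[_ smooth] _] := N_normal; exact: smooth. Qed.

Let gE y : (Defs.coord a @` overlap psi a c) y -> gM a y =
  jacobian phi y *m lorentz_mx gF c (phi y) *m (jacobian phi y)^T.
Proof.
move=> [q [aq cq] <-]; have [_ _ _ _ gE] := psi_hyp.
by rewrite phiE// (gE a c q).
Qed.

Let nuE y : (Defs.coord a @` overlap psi a c) y ->
  nu y *m lorentz_mx gF c (phi y) *m (jacobian phi y)^T = 0.
Proof.
move=> [q [aq cq] <-]; have [_ /(_ c q cq)[nuE _ _]] := N_normal.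
rewrite phiE// /= coordK//; apply/rowP => j.
rewrite entry_row row_id rowE [RHS]mxE.
exact: nuE.
Qed.

Let nu1 y : (Defs.coord a @` overlap psi a c) y ->
  nu y *m lorentz_mx gF c (phi y) *m (nu y)^T = -1%:M.
Proof.
move=> [q [aq cq] <-]; have [_ /(_ c q cq)[_ nu1 _]] := N_normal.
rewrite phiE// /= coordK// [LHS]mx11_scalar -[_ 0 0]/(lorentz gF c (psi q) _ _).
by rewrite nu1 raddfN.
Qed.

Let gunit : gM a x \in unitmx.
Proof.
by apply: posdef_unitmx; apply: gmx_posdef; exists p.
Qed.

Let row_freeE : row_free (jacobian phi x).
Proof. by have [_ _ _ rf _] := psi_hyp; exact: rf. Qed.

Lemma height_gradient :
  \sum_i \sum_j invmx (gM a x) i j *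
    (partial i (height a) x * partial j (height a) x) = N c p 0 t0 ^+ 2 - 1.
Proof.
rewrite (heightE a c).
rewrite (hypersurface_gradient Uo Ux phi_smooth gE nuE nu1
  (lorentz_mx_sym gF cphi) gunit).
  by rewrite /= coordK.
by move=> k; exact: lorentz_mx_rowt.
Qed.

Lemma height_laplacian :
  laplacian (gM a) (height a) x = n%:R * H * N c p 0 t0.
Proof.
rewrite (heightE a c).
rewrite (hypersurface_laplacian Uo Ux phi_smooth nu_smooth
  gE nuE nu1 (lorentz_mx_sym gF cphi) (lorentz_mx_differentiable gF cphi) gunit
  row_freeE (lorentz_christoffel_t gF c (phi x))).
rewrite /= coordK//; congr (_ * _).
(* The minus signs of [mean_curvature] and [shape_operator] cancel, so [n H] is the trace of the
   covariant derivative of [N]. *)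
rewrite -(cmc acp) /mean_curvature /shape_operator mulNmx [\tr (- _)]raddfN /=
  !mulrN opprK.
rewrite mulVKf ?pnatr_eq0 -?lt0n//; congr (\tr (_ *m _)).
apply/matrixP => j k; rewrite [LHS]mxE [RHS]mxE covdE; congr (_ + _).
apply: eq_bigr => l _; apply: eq_bigr => m _.
rewrite phiE// /= coordK//; congr (_ * _ * _).
rewrite dmxE_jacobian ?mxE// => b.
exact: smooth_on_differentiable Uo (phi_smooth 0 b) Ux.
Qed.

Lemma lorentz_partial_t : lorentz gF c (psi p) (N c p) (@partial_t R n) = - N c
  p 0 t0.
Proof.
rewrite /lorentz /partial_t mxE (bigD1 t0)//= big1 => [|k kt]; last first.
  case: (split_ordP k) kt => j ->; first by rewrite !ord1 eqxx.
  by rewrite [_^T _ _]mxE row_mxEr [X in _ * X]mxE mulr0.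
rewrite [_^T _ _]mxE row_mxEl [_%:M _ _]mxE eqxx mulr1 addr0 mxE (bigD1 t0)//=
  big1.
  by rewrite lorentz_mx_rowt eqxx addr0 mulrN1.
by move=> k kt; rewrite lorentz_mx_colt eq_sym (negbTE kt) oppr0 mulr0.
Qed.

End AtPoint.

End HypersurfaceInProduct.

(** * Bounds on the hyperbolic angle and the contradiction *)

Lemma cosh_ge1 (R : realType) (x : R) : 1 <= cosh x.
Proof.
rewrite /cosh ler_pdivlMr// mul1r.
have := expR_ge1Dx x; have := expR_ge1Dx (- x); lra.
Qed.

Lemma cosh_le_expR (R : realType) (x b : R) : 0 <= x -> x <= b -> cosh x <=
  expR b.
Proof.
move=> x0 xb; rewrite /cosh ler_pdivrMr//.
have h1 : expR x <= expR b by rewrite ler_expR.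
have h2 : expR (- x) <= expR b by rewrite ler_expR; lra.
lra.
Qed.

Lemma laplacian_cst (R : realType) (n : nat) (G : 'rV[R]_n -> 'M[R]_n) (k : R)
  x :
  laplacian G (cst k) x = 0.
Proof.
have D0 (r : R) i : partial i (cst r) = cst 0.
  by apply/funext => y; exact: derive_cst.
rewrite /laplacian big1// => i _; rewrite big1// => j _.
by rewrite !D0 big1 ?subrr ?mulr0// => l _; rewrite D0 mulr0.
Qed.

Theorem theorem11 (R : realType) (n : nat) (F : manifold R n)
    (gF : riem_metric F) (I : set R) :
  (2 <= n)%N ->
  connected [set: F] ->
  open I -> is_interval I -> I !=set0 ->
  nonneg_ricci gF ->
  ~ exists (M : manifold R n) (gM : riem_metric M) (psi : M -> R * F)
      (N : chart F -> M -> 'rV[R]_(1 + n)) (phi : M -> R) (H : R),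
    [/\ spacelike_hypersurface gF gM psi I,
        complete_metric gM,
        parabolic gM &
        [/\ unit_normal gF psi N,
            hyperbolic_angle gF psi N phi,
            has_ubound (range phi),
            constant_mean_curvature gF psi N H &
            H != 0]].
Proof.
move=> n2 _ _ _ _ _ [M [gM [psi [N [phi [H]]]]]].
move=> [psi_hyp _ [Mnc par] [N_normal angle [b phib] cmc H0]].
have n0 : (0 < n)%N by exact: ltnW.
pose C := expR b; pose k := H / C ^+ 2.
have C0 : 0 < C by exact: expR_gt0.
pose u (p : M) := expR (k * (psi p).1).
have smooth (a : chart M) : smooth_on (img a) (fun y => (psi (para a y)).1).
  exact (@height_smooth _ _ _ _ _ _ _ _ psi_hyp a).
have lap_neg a x : img a x -> laplacian (gM a) (u \o para a) x < 0.
  move=> ax; have [p ap px] := ax; have [c cp] := dom_cover (psi p).2.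
  have acp : overlap psi a c p by [].
  have Uo : open (img a) by exact: img_open.
  have := laplacian_exp k Uo (smooth a) (gM a) ax.
  move=> ->; rewrite pmulr_rlt0 ?expR_gt0// -px.
  rewrite (height_laplacian n0 psi_hyp N_normal cmc acp).
  rewrite (height_gradient psi_hyp N_normal acp).
  have [phi0 /(_ c cp)] := angle p; rewrite lorentz_partial_t.
  set s := N c p 0 _ => coshE.
  have s1 : 1 <= - s by rewrite -coshE; exact: cosh_ge1.
  have sC : - s <= C.
    by rewrite -coshE; apply: cosh_le_expR => //; apply: phib; exists p.
  (* Factoring out a square removes the sign of [H] and leaves two quantities separated by [1]. *)
  have -> : k * (n%:R * H * s) + k ^+ 2 * (s ^+ 2 - 1) =
      (H / C) ^+ 2 * ((s ^+ 2 - 1) / C ^+ 2 - n%:R * - s).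
    by rewrite /k; field; rewrite gt_eqF.
  rewrite pmulr_rlt0; last by rewrite exprn_even_gt0//= mulf_neq0// invr_eq0
    gt_eqF.
  rewrite subr_lt0; apply: (@lt_le_trans _ _ 1).
    rewrite ltr_pdivrMr ?exprn_gt0// mul1r ltrBlDr.
    have : s ^+ 2 <= C ^+ 2 by rewrite -sqrrN lerXn2r// nnegrE; lra.
    by lra.
  have n1 : 1 <= n%:R :> R by rewrite ler1n.
  by rewrite -[leLHS]mul1r; apply: ler_pM.
have [||m um] := par u.
- move=> a; split=> [|x ax]; last exact/ltW/lap_neg.
  have Uo : open (img a) by exact: img_open.
  exact: exp_C2 k Uo (smooth a).
- by move=> p; exact: expR_gt0.
(* At any point the constant [u] would have zero Laplacian, against [lap_neg]. So [M] would be
   empty, hence compact, which the non-compactness in [parabolic] excludes. *)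
apply: Mnc; rewrite (_ : [set: M] = set0); first exact: compact0.
rewrite -subset0 => p _; have [a ap] := dom_cover p.
have ax : img a (Defs.coord a p) by exists p.
have := lap_neg a _ ax; rewrite (_ : u \o para a = cst m) ?laplacian_cst
  ?ltxx//.
by apply/funext => y; exact: um.
Qed.
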